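(* Let $G$ be an infinite, countable, connected graph of uniformly bounded degree, with an exhaustion $\{\Lambda_n\}_{n\in\mathbb{N}}$ by finite regions with respect to which the adjacency operator $A_G$ admits the integrated density of states. Let $\{\mu_n\}$ be a sequence with $\mu_n<\|A_G\|-\|A_{\Lambda_n}\|$ and $\mu_n\to0$, and let $\omega_n$ be the corresponding finite volume Gibbs states for $H=\|A_G\|\mathbf{1}-A_G$ at inverse temperature $1$, with two-point function $\omega_n(a^\dagger(u_1)a(u_2))=\langle(e^{H_n-\mu_n\mathbf{1}_n}-\mathbf{1}_n)^{-1}u_1,u_2\rangle$. If $G$ is recurrent (i.e. $A_G$ is recurrent), then for each vertex $x\in G$, $$\lim_n\omega_n(a^\dagger(\delta_x)a(\delta_x))=+\infty .$$
   Context: The adjacency matrix is $(A_G)_{xy}=$ number of edges joining $x$ and $y$ (multiple edges and loops allowed), a bounded selfadjoint operator on $\ell^2(G)$. The finite regions $\Lambda_n$ increase to $G$; $P_n$ is the orthogonal projection onto $\ell^2(\Lambda_n)$, $A_{\Lambda_n}=P_nA_GP_n$, $H_n=P_nHP_n=\|A_G\|\mathbf{1}_n-A_{\Lambda_n}$ and $\mathbf{1}_n$ is the identity of $\ell^2(\Lambda_n)$. For $u_1,u_2\in\ell^2(\Lambda_n)$, $\omega_n(a^\dagger(u_1)a(u_2))$ is the number given by the displayed formula; for a vertex $x$, it is considered for $n$ so large that $x\in\Lambda_n$. $A_G$ admits the integrated density of states if $\lim_n|\Lambda_n|^{-1}\operatorname{Tr}f(A_{\Lambda_n})$ exists for every continuous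 $f$ on $[-\|A_G\|,\|A_G\|]$. $A_G$ is recurrent if $\lim_{\lambda\downarrow\|A_G\|}\langle(\lambda\mathbf{1}-A_G)^{-1}\delta_x,\delta_x\rangle=+\infty$ for some (equivalently every) vertex $x$. *)

(* Defs.v *)
From HB Require Import structures.
From mathcomp Require Import all_boot all_order all_algebra.
From mathcomp Require Import finmap complex spectral.
From mathcomp Require Import all_classical all_reals all_analysis.
From mathcomp.analysis Require showcase.summability.
Set Implicit Arguments.
Unset Strict Implicit.
Unset Printing Implicit Defensive.
Import Order.TTheory GRing.Theory Num.Theory.
Import numFieldNormedType.Exports.
Local Open Scope classical_set_scope.
Local Open Scope complex_scope.
Local Open Scope ring_scope.

(* Undirected graphs with loops and multiple edges: [edges G x y] is the number
   of edges joining x and y. *)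
Record multigraph (V : Type) := Multigraph {
  edges :> V -> V -> nat;
  edges_sym : forall x y, edges x y = edges y x }.

Section Graph.
Variables (V : countType) (G : multigraph V).

Definition connected_graph :=
  forall x y : V, exists2 p, path (fun a b => 0 < G a b)%N x p & last x p = y.

Definition bounded_degree :=
  exists D : nat, forall (x : V) (S : {fset V}), (\sum_(y <- S) G x y <= D)%N.

Definition exhaustion (L : nat -> {fset V}) :=
  (forall n, L n `<=` L n.+1)%fset /\ (forall x, exists n, x \in L n).

End Graph.

Section HilbertSpace.
Variables (R : realType) (I : choiceType).
Implicit Types (u v : I -> R[i]) (T : (I -> R[i]) -> (I -> R[i])).

Definition l2sqnorm u : \bar R :=
  (\esum_(x in [set: I]) ((ComplexField.Normc.normc (u x)) ^+ 2)%:E)%E.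

Definition l2norm u : R := Num.sqrt (fine (l2sqnorm u)).

Definition ell2 : set (I -> R[i]) := [set u | (l2sqnorm u < +oo)%E].

(* Unordered sum, linear in the first argument. *)
Definition inner u v : R[i] :=
  summability.sum (fun x => u x * (v x)^* : R[i]^o).

Definition delta (x : I) : I -> R[i] := fun y => (y == x)%:R.

Definition opnorm T : R :=
  sup [set l2norm (T u) | u in [set u | ell2 u /\ l2norm u <= 1]].

(* The inverse of T as a map of ell2. *)
Definition op_inv T : (I -> R[i]) -> (I -> R[i]) :=
  'pinv_(fun=> (fun=> 0)) ell2 T.

End HilbertSpace.
Arguments delta R {I} x.

Section FiniteDimension.
Variable R : realType.

(* The operator on l^2(F) of a matrix indexed by the enumeration of F. *)
Definition mxop (F : finType) (M : 'M[R[i]]_#|F|) (u : F -> R[i]) : F -> R[i] :=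
  fun x => \sum_(y : F) M (enum_rank x) (enum_rank y) * u y.

(* The matrix of P T P on l^2(L), P the orthogonal projection onto l^2(L). *)
Definition compression (V : choiceType) (L : {fset V})
    (T : (V -> R[i]) -> (V -> R[i])) : 'M[R[i]]_#|{: L}| :=
  \matrix_(i, j) inner (T (delta R (val (enum_val j))))
                       (delta R (val (enum_val i))).

(* Functional calculus of a selfadjoint matrix; its eigenvalues are real. *)
Definition mxfun n (f : R -> R[i]) (M : 'M[R[i]]_n) : 'M[R[i]]_n :=
  invmx (spectralmx M)
  *m diag_mx (map_mx (fun z : R[i] => f (complex.Re z)) (spectral_diag M))
  *m spectralmx M.

Definition mxexp n (M : 'M[R[i]]_n) : 'M[R[i]]_n :=
  mxfun (fun t => (expR t)%:C) M.

End FiniteDimension.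

Section Adjacency.
Variables (R : realType) (V : countType) (G : multigraph V).

(* The sum has finitely many nonzero terms when G has bounded degree. *)
Definition adjacency (u : V -> R[i]) : V -> R[i] :=
  fun x => \sum_(y \in [set: V]) (G x y)%:R * u y.

Definition normA : R := opnorm adjacency.

Definition adjacency_in (L : {fset V}) : 'M[R[i]]_#|{: L}| :=
  compression L adjacency.

Definition resolvent (lambda : R) : (V -> R[i]) -> (V -> R[i]) :=
  op_inv (fun u x => lambda%:C * u x - adjacency u x).

(* In R[i] the filter +oo is that of the half-lines of real numbers: the
   values are real and tend to +oo. *)
Definition recurrent :=
  exists x : V,
    inner (resolvent lambda (delta R x)) (delta R x)
      @[lambda --> normA^'+] --> (+oo : set_system R[i]).

Definition admits_ids (L : nat -> {fset V}) :=
  forall f : R -> R[i]^o, {within `[- normA, normA], continuous f} ->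
    cvgn (fun n => (#|` L n|%:R)^-1 * \tr (mxfun f (adjacency_in (L n)))
            : R[i]^o).

Definition hamiltonian (u : V -> R[i]) : V -> R[i] :=
  fun x => normA%:C * u x - adjacency u x.

Definition hamiltonian_in (L : {fset V}) : 'M[R[i]]_#|{: L}| :=
  compression L hamiltonian.

(* The two-point function omega(a^dagger(u1) a(u2)) of the Gibbs state at
   inverse temperature 1 and chemical potential mu in the region L. *)
Definition two_point (L : {fset V}) (mu : R) (u1 u2 : L -> R[i]) : R[i] :=
  inner (mxop (invmx (mxexp (hamiltonian_in L - (mu%:C)%:M) - 1%:M)) u1) u2.

(* P u as an element of l^2(L). *)
Definition restrict_to (L : {fset V}) (u : V -> R[i]) : L -> R[i] :=
  fun x => u (val x).

End Adjacency.
Arguments two_point {R V} G L mu u1 u2.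
Arguments restrict_to {R V} L u.

(* Main.v *)
(** Recurrence forces the Green series [\sum_k w_k(x) / ||A||^(k+1)] of the
    numbers of closed walks at [x] to diverge: above [||A||] the diagonal of the
    resolvent is the Neumann series.  Finitely many of the [w_k(x)] are already
    diagonal entries of the powers of the finite-volume adjacency matrix [A_n]
    once the region is large.  Since [1/(e^s - 1) >= 1/s - 1] for [s > 0], the
    spectral theorem bounds the two-point function below by the diagonal of
    [(lambda_n - A_n)^-1 - 1] with [lambda_n = ||A|| - mu_n], hence by any
    partial sum, with an even number of terms, of its Neumann series, minus 1.
    As [lambda_n --> ||A||], these partial sums become arbitrarily large. *)
Require Import Defs.
From HB Require Import structures.
From mathcomp Require Import all_boot all_order all_algebra.
From mathcomp Require Import finmap complex spectral.
From mathcomp Require Import all_classical all_reals all_analysis.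
From mathcomp Require Import ring lra.
Set Implicit Arguments.
Unset Strict Implicit.
Unset Printing Implicit Defensive.
Import Order.TTheory GRing.Theory Num.Theory.
Import numFieldNormedType.Exports.
Local Open Scope classical_set_scope.
Local Open Scope complex_scope.
Local Open Scope ring_scope.

(** * The pseudo-inverse and finite neighborhoods *)

Lemma pinv_image (T U : Type) (d : U -> T) (A : set T) (f : T -> U) y :
  (f @` A) y -> A ('pinv_d A f y) /\ f ('pinv_d A f y) = y.
Proof.
move=> fy; split; last by apply: pinvK; rewrite inE.
have fy' : ([fun f in A] @` A) y by case: fy => x Ax <-; exists x.
exact: 'invS_('split_d [fun f in A]).
Qed.

(** Off the image of [ell2] the resolvent takes a default value, the zero function; this case has to
    be excluded later. *)
Lemma pinv_dflt (T U : Type) (d : U -> T) (A : set T) (f : T -> U) y :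
  ~ (f @` A) y -> 'pinv_d A f y = d y.
Proof. by move=> nf; rewrite /pinv_ splitV oinv_surj; case: pselect. Qed.

Definition neighborhoods (V : countType) (G : multigraph V)
    (nb : V -> {fset V}) :=
  forall x y, (0 < G x y)%N -> y \in nb x.

Lemma exists_neighborhoods (V : countType) (G : multigraph V) :
  bounded_degree G -> exists nb, neighborhoods G nb.
Proof.
move=> [D degD].
suff fin x : finite_set [set y | (0 < G x y)%N].
  exists (fun x => fset_set [set y | (0 < G x y)%N]) => x y Gxy.
  by rewrite in_fset_set // inE.
apply: contrapT => /(infinite_set_fset D.+1)[B BG cardB].
suff : (D.+1 <= D)%N by rewrite ltnn.
apply: leq_trans cardB _; apply: leq_trans (degD x B).
rewrite -sum1_size big_seq [leqRHS]big_seq.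
by apply: leq_sum => y yB; apply: BG.
Qed.

(** * Counting walks *)

Section Walks.
Variables (V : countType) (G : multigraph V) (nb : V -> {fset V}).
Hypothesis nbP : neighborhoods G nb.

(** When [nb] covers the neighbors, this is the $(x,y)$ entry of the $k$-th power of the adjacency
    matrix. The target comes first, and the recursion peels off the first step from [x]. *)
Fixpoint walks (k : nat) (y x : V) : nat :=
  if k is k'.+1 then \sum_(z <- nb x) G x z * walks k' y z else (x == y).

(** The left side counts the walks that are at [z] after [m] steps. *)
Lemma walksM m k x y z : (walks m z x * walks k y z <= walks (m + k) y x)%N.
Proof.
elim: m x => [|m IH] x /=.
  by case: eqP => [->|_]; rewrite ?mul1n.
rewrite big_distrl /=; apply: leq_sum => w _.
by rewrite -mulnA leq_mul2l IH orbT.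
Qed.

Lemma walks_path x p :
  path (fun a b => 0 < G a b)%N x p -> (0 < walks (size p) (last x p) x)%N.
Proof.
elim: p x => [|z p IH] x /=; first by rewrite eqxx.
move=> /andP[Gxz /IH wz]; have zx := nbP Gxz.
rewrite (big_fsetD1 z) //=; apply: leq_trans (leq_addr _ _).
by rewrite muln_gt0 Gxz.
Qed.

End Walks.

(** * Norms on $\ell^2$ and operator norms *)

Section Ell2.
Variables (R : realType) (I : choiceType).
Implicit Types (u : I -> R[i]) (c : R) (S : {fset I}).
Local Notation normc := ComplexField.Normc.normc.

Lemma normc_ge0 (z : R[i]) : 0 <= normc z.
Proof. by case: z => a b; rewrite sqrtr_ge0. Qed.

Lemma norm_normc (z : R[i]) : `|z| = (normc z)%:C.
Proof. by case: z. Qed.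

Lemma normc_real c : normc c%:C = `|c|.
Proof. by rewrite /= expr0n addr0 sqrtr_sqr. Qed.

Lemma normc_nat n : normc (n%:R : R[i]) = n%:R.
Proof. by rewrite -(rmorph_nat (real_complex R)) normc_real normr_nat. Qed.

Lemma normc_sum (J : Type) (r : seq J) (F : J -> R[i]) :
  normc (\sum_(j <- r) F j) <= \sum_(j <- r) normc (F j).
Proof.
rewrite -lecR -norm_normc rmorph_sum /=; apply: le_trans (ler_norm_sum _ _ _) _.
by apply: ler_sum => j _; rewrite norm_normc.
Qed.

Lemma l2sqnorm_ge0 u : (0 <= l2sqnorm u)%E.
Proof. by apply: esum_ge0 => x _; rewrite lee_fin sqr_ge0. Qed.

Lemma l2sqnorm_ge u S : ((\sum_(x <- S) normc (u x) ^+ 2)%:E <= l2sqnorm u)%E.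
Proof.
apply: ereal_sup_ubound; exists [set` S] => /=; first by split.
by rewrite -fsbig_seq // sumEFin.
Qed.

Lemma l2sqnorm_le u c :
  (forall S, \sum_(x <- S) normc (u x) ^+ 2 <= c) -> (l2sqnorm u <= c%:E)%E.
Proof.
move=> le; apply: ge_ereal_sup => _ [A [finA _] <-].
by rewrite fsbig_finite // sumEFin lee_fin le.
Qed.

Lemma ell2_fin u : ell2 u -> (l2norm u ^+ 2)%:E = l2sqnorm u.
Proof.
move=> u2; have fin : l2sqnorm u \is a fin_num.
  by rewrite ge0_fin_numE ?l2sqnorm_ge0.
by rewrite sqr_sqrtr ?fineK // fine_ge0 // l2sqnorm_ge0.
Qed.

Lemma l2norm_ge0 u : 0 <= l2norm u.
Proof. exact: sqrtr_ge0. Qed.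

Lemma ell2_sum_le u S :
  ell2 u -> \sum_(x <- S) normc (u x) ^+ 2 <= l2norm u ^+ 2.
Proof. by move=> u2; rewrite -lee_fin ell2_fin // l2sqnorm_ge. Qed.

(** The squared norm is a supremum over finite sets, so uniform bounds on finite sums give both
    membership and the norm estimate. *)
Lemma ell2_bound u c : 0 <= c ->
  (forall S, \sum_(x <- S) normc (u x) ^+ 2 <= c ^+ 2) ->
  ell2 u /\ l2norm u <= c.
Proof.
move=> c0 /l2sqnorm_le le.
have u2 : ell2 u by apply: le_lt_trans le _; rewrite ltry.
by split=> //; rewrite -lee_fin in le *; move: le;
  rewrite -ell2_fin // !lee_fin ler_pXn2r ?nnegrE ?l2norm_ge0.
Qed.

Lemma ell2_coord u x : ell2 u -> normc (u x) <= l2norm u.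
Proof.
move=> /(ell2_sum_le [fset x]%fset); rewrite big_seq_fset1.
by rewrite ler_pXn2r ?nnegrE ?l2norm_ge0 ?normc_ge0.
Qed.

Lemma ell2_scale u c : ell2 u ->
  ell2 (fun x => c%:C * u x) /\ l2norm (fun x => c%:C * u x) <= `|c| * l2norm u.
Proof.
move=> u2; apply: ell2_bound => [|S]; first by rewrite mulr_ge0 ?l2norm_ge0.
under eq_bigr do rewrite ComplexField.Normc.normcM normc_real exprMn.
by rewrite -mulr_sumr exprMn ler_wpM2l ?sqr_ge0 // ell2_sum_le.
Qed.

Section Opnorm.
Variables (T : (I -> R[i]) -> I -> R[i]) (C : R).
Hypothesis TZ : forall c u, T (fun x => c%:C * u x) = fun x => c%:C * T u x.
Hypothesis T_bound : forall u, ell2 u -> ell2 (T u) /\ l2norm (T u) <= C * l2norm u.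

(** Rescale [u] into the unit ball. [T_bound] makes [opnorm T] a genuine supremum and settles the
    case of norm zero, where no rescaling is possible. *)
Lemma l2norm_opnorm u : ell2 u -> l2norm (T u) <= opnorm T * l2norm u.
Proof.
move=> u2; have [Tu2 TuC] := T_bound u2.
have [u0|u_gt0] := eqVneq (l2norm u) 0.
  by move: TuC; rewrite u0 !mulr0.
have {}u_gt0 : 0 < l2norm u by rewrite lt0r u_gt0 l2norm_ge0.
pose v x := (l2norm u)^-1%:C * u x.
have [v2 vn] := ell2_scale (l2norm u)^-1 u2.
have {}vn : l2norm v <= 1.
  by move: vn; rewrite ger0_norm ?invr_ge0 ?l2norm_ge0 // mulVf ?gt_eqF.
have uE : u = fun x => (l2norm u)%:C * v x.
  by apply/funext => x; rewrite mulrA -rmorphM /= mulfV ?gt_eqF // mul1r.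
have [Tv2 _] := T_bound v2.
have [_] := ell2_scale (l2norm u) Tv2.
rewrite -TZ -uE => /le_trans; apply.
rewrite ger0_norm ?l2norm_ge0 // mulrC ler_wpM2r ?l2norm_ge0 //.
apply: ub_le_sup; last by exists v.
(* The sign of [C] is unknown, hence the absolute value. *)
exists `|C| => _ [w [w2 w1] <-]; have [_ /le_trans] := T_bound w2; apply.
apply: le_trans (_ : `|C| * l2norm w <= _).
  by rewrite ler_wpM2r ?l2norm_ge0 ?ler_norm.
by rewrite -[leRHS]mulr1 ler_wpM2l.
Qed.

End Opnorm.

(** A set without a supremum has [sup] equal to 0, so this holds for unbounded maps as well. *)
Lemma opnorm_ge0 (T : (I -> R[i]) -> I -> R[i]) : 0 <= opnorm T.
Proof.
rewrite /opnorm; set E := (X in sup X).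
have [supE|/sup_out-> //] := pselect (has_sup E).
have [x Ex] := supE.1; apply: le_trans (sup_upper_bound supE Ex).
by case: Ex => u _ <-; apply: l2norm_ge0.
Qed.

End Ell2.

Section InnerDelta.
Variables (R : realType) (I : choiceType).

(** Partial sums are constant as soon as the finite set contains [x]. *)
Lemma summability_sum1 (f : I -> R[i]^o) x :
  (forall y, y != x -> f y = 0) -> summability.sum f = f x.
Proof.
move=> f0; apply: lim_near_cst;
  [exact: norm_hausdorff|exact: summability.totally_filter|].
exists [fset x]%fset => // B /= xB.
have {}xB : x \in B by apply: (fsubsetP xB); rewrite inE.
rewrite /summability.partial_sum (bigD1 [` xB]%fset) //= big1 ?addr0 // => i ix.
by apply: f0; apply: contraNneq ix => ix; apply/eqP/val_inj.
Qed.

Lemma inner_delta (u : I -> R[i]) x : inner u (delta R x) = u x.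
Proof.
rewrite /inner (summability_sum1 (x := x)) => [|y yx]; rewrite /delta.
  by rewrite eqxx rmorph1 mulr1.
by rewrite (negPf yx) rmorph0 mulr0.
Qed.

End InnerDelta.

(** Lagrange's identity: twice the difference of the two sides is $\sum_{i,j} g_i g_j
    (c_i-c_j)^2$. *)
Lemma weighted_cauchy_schwarz (R : realType) (J : Type) (r : seq J)
    (g c : J -> R) : (forall j, 0 <= g j) ->
  (\sum_(j <- r) g j * c j) ^+ 2
    <= (\sum_(j <- r) g j) * (\sum_(j <- r) g j * c j ^+ 2).
Proof.
move=> g0; rewrite -subr_ge0 -(pmulr_rge0 _ (ltr0Sn R 1)).
suff -> : 2 * ((\sum_(j <- r) g j) * (\sum_(j <- r) g j * c j ^+ 2) -
  (\sum_(j <- r) g j * c j) ^+ 2) =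
  \sum_(i <- r) \sum_(j <- r) g i * g j * (c i - c j) ^+ 2.
  by apply: sumr_ge0 => i _; apply: sumr_ge0 => j _; rewrite mulr_ge0 ?sqr_ge0 ?mulr_ge0.
rewrite mulrBr mulrDl mul1r {2}[_ * (\sum_(j <- r) g j * c j ^+ 2)]mulrC.
rewrite expr2 !big_distrlr /= mulr_sumr -big_split -sumrB /=.
apply: eq_bigr => i _; rewrite mulr_sumr -big_split -sumrB /=.
by apply: eq_bigr => j _; ring.
Qed.

(** * The adjacency operator and its Green series *)

Section Adjacency.
Variables (R : realType) (V : countType) (G : multigraph V).
Variables (nb : V -> {fset V}).
Hypothesis nbP : neighborhoods G nb.
Local Notation normc := ComplexField.Normc.normc.
Local Notation A := (@adjacency R V G).

Lemma adjacencyE (u : V -> R[i]) x (S : {fset V}) : (nb x `<=` S)%fset ->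
  A u x = \sum_(y <- S) (G x y)%:R * u y.
Proof.
move=> /fsubsetP nbS; rewrite /adjacency (@fsbigTE _ _ _ _ S) // => y yS.
have [->|] := posnP (G x y); first by rewrite mul0r.
by move=> /nbP /nbS; rewrite (negPf yS).
Qed.

Lemma adjacencyZ c (u : V -> R[i]) :
  A (fun x => c%:C * u x) = fun x => c%:C * A u x.
Proof.
apply/funext => x; rewrite !(@adjacencyE _ _ (nb x)) // mulr_sumr.
by apply: eq_bigr => y _; rewrite mulrCA.
Qed.

Lemma adjacency_ZB c (u v : V -> R[i]) :
  A (fun x => c * u x - v x) = fun x => c * A u x - A v x.
Proof.
apply/funext => x; rewrite !(@adjacencyE _ _ (nb x)) // mulr_sumr -sumrB.
by apply: eq_bigr => y _; rewrite mulrBr mulrCA.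
Qed.

Lemma iter_adjacency_ZB k c (u v : V -> R[i]) :
  iter k A (fun x => c * u x - v x) = fun x => c * iter k A u x - iter k A v x.
Proof. by elim: k => //= k ->; rewrite adjacency_ZB. Qed.

Lemma iter_adjacency_delta k x y :
  iter k A (delta R y) x = (walks G nb k y x)%:R.
Proof.
elim: k x => [//|k IH] x /=.
rewrite (@adjacencyE _ _ (nb x)) // natr_sum.
by apply: eq_bigr => z _; rewrite IH natrM.
Qed.

Section Bounded.
Variable D : nat.
Hypothesis degD : forall (x : V) (S : {fset V}), (\sum_(y <- S) G x y <= D)%N.

(** Schur's test: Cauchy-Schwarz with weights [G x y] uses the row sums, at most [D]; after
    exchanging the sums, the column sums are at most [D] by symmetry. *)
Lemma adjacency_bound (u : V -> R[i]) :
  ell2 u -> ell2 (A u) /\ l2norm (A u) <= D%:R * l2norm u.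
Proof.
move=> u2; apply: ell2_bound => [|S]; first by rewrite mulr_ge0 ?l2norm_ge0.
pose N := (\bigcup_(x <- S) nb x)%fset.
apply: le_trans (_ : \sum_(x <- S) (D%:R : R) *
    (\sum_(y <- N) (G x y)%:R * normc (u y) ^+ 2) <= _).
  rewrite big_seq [leRHS]big_seq; apply: ler_sum => x xS.
  have nbN : (nb x `<=` N)%fset by apply: bigfcup_sup.
  apply: le_trans (_ : (\sum_(y <- N) (G x y)%:R * normc (u y)) ^+ 2 <= _).
    rewrite ler_pXn2r ?nnegrE ?normc_ge0 //; last first.
      by apply: sumr_ge0 => y _; rewrite mulr_ge0 ?normc_ge0.
    rewrite (adjacencyE _ nbN); apply: le_trans (normc_sum _ _) _.
    by apply: ler_sum => y _; rewrite ComplexField.Normc.normcM normc_nat.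
  apply: le_trans (weighted_cauchy_schwarz _ _ _) _ => //.
  rewrite ler_wpM2r ?sumr_ge0 // => [y _|]; first by rewrite mulr_ge0 ?sqr_ge0.
  by rewrite -natr_sum ler_nat degD.
rewrite -mulr_sumr exchange_big /= exprMn [D%:R ^+ 2]expr2 -mulrA ler_wpM2l //.
apply: le_trans (_ : \sum_(y <- N) (D%:R : R) * normc (u y) ^+ 2 <= _).
  apply: ler_sum => y _; rewrite -mulr_suml ler_wpM2r ?sqr_ge0 //.
  rewrite -natr_sum ler_nat; apply: leq_trans (degD y S).
  by rewrite leq_eqVlt; apply/orP; left; apply/eqP/eq_bigr => x _; rewrite edges_sym.
by rewrite -mulr_sumr ler_wpM2l // ell2_sum_le.
Qed.

Lemma iter_adjacency_bound k (u : V -> R[i]) : ell2 u ->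
  ell2 (iter k A u) /\ l2norm (iter k A u) <= normA R G ^+ k * l2norm u.
Proof.
move=> u2; elim: k => [|k [IH2 IHn]]; first by rewrite mul1r.
split; first by have [] := adjacency_bound IH2.
apply: le_trans (l2norm_opnorm adjacencyZ adjacency_bound IH2) _.
by rewrite exprS -mulrA ler_wpM2l // opnorm_ge0.
Qed.

(** The Neumann series with exact remainder, from iterating $u = \lambda^{-1}(\delta_y + Au)$. *)
Lemma resolvent_walks (lambda : R) (u : V -> R[i]) y N : 0 < lambda ->
  (fun x => lambda%:C * u x - A u x) = delta R y ->
  u y = (\sum_(k < N) lambda ^- k.+1 * (walks G nb k y y)%:R)%:C
        + (lambda ^- N)%:C * iter N A u y.
Proof.
move=> l0 uE; have lN0 : lambda%:C != 0 by rewrite fmorph_eq0 gt_eqF.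
elim: N => [|N IH]; first by rewrite big_ord0 add0r invr1 mul1r.
have rec : iter N A u y =
    lambda%:C^-1 * ((walks G nb N y y)%:R + iter N.+1 A u y).
  rewrite -iter_adjacency_delta -uE iter_adjacency_ZB -iterSr subrK.
  by rewrite mulKf.
rewrite IH rec big_ord_recr /= rmorphD /= -addrA; congr (_ + _).
rewrite mulrA -fmorphV -rmorphM /= -invfM -exprSr mulrDr; congr (_ + _).
by rewrite rmorphM rmorph_nat.
Qed.

(** Divergence in a form that only involves finite sums. The bound on [l] from above later controls
    a fixed power of [l]. *)
Lemma recurrent_walks : recurrent R G -> exists y, forall M, exists l : R,
  exists N, [/\ normA R G < l, l < normA R G + 1 &
    M < \sum_(k < N) l ^- k.+1 * (walks G nb k y y)%:R].
Proof.
move=> [y rec]; exists y => M; set a := normA R G.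
have a0 : 0 <= a := opnorm_ge0 _.
(* Nonnegativity of the threshold excludes the default value 0 of the resolvent. *)
pose M' := Num.max M 0.
have : \forall l \near a^'+,
    M'%:C < inner (resolvent G l (delta R y)) (delta R y).
  apply: (rec [set z | M'%:C < z]); exists M'%:C; split=> //.
  by rewrite complex_real.
move=> near_l; near a^'+ => l.
have al : a < l by near: l; apply: nbhs_right_gt.
have la : l < a + 1 by near: l; apply: nbhs_right_lt; rewrite ltrDl.
have : M'%:C < inner (resolvent G l (delta R y)) (delta R y) by near: l.
have l0 : 0 < l by apply: le_lt_trans al.
rewrite inner_delta /resolvent /op_inv; set u := pinv_ _ _ _ _.
move=> Mu; exists l.
have [[u2 uE]|u0] : (ell2 u /\ (fun x => l%:C * u x - A u x) = delta R y)
    \/ u = (fun=> 0).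
  have [|] := pselect (((fun (u : V -> R[i]) x => l%:C * u x - A u x) @`
      (@ell2 R V)) (delta R y)).
    by move=> im; left; apply: pinv_image im.
  by move=> im; right; apply: pinv_dflt im.
  (* The remainder is at most $q^N\|u\|$ with $q<1$, so some [N] brings it below the gap between
     [u y] and [M']. *)
  pose q := a / l.
  have q0 : 0 <= q by rewrite divr_ge0 // ltW.
  have qn : q ^+ n * l2norm u @[n --> \oo] --> (0 : R).
    rewrite -(mul0r (l2norm u)); apply: cvgMl; apply: cvg_expr.
    by rewrite ger0_norm // ltr_pdivrMr // mul1r.
  have e0 : 0 < complex.Re (u y) - M'.
    by move: Mu; rewrite ltcE /= subr_gt0 => /andP[].
  have [N _ /(_ N (leqnn N)) /= qN] := cvgr_lt _ qn _ e0.
  exists N; split=> //; apply: le_lt_trans (_ : M' < _).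
    by rewrite le_max lexx.
  set s := \sum_(k < N) _; pose r := (l ^- N)%:C * iter N A u y.
  have us : u y = s%:C + r by rewrite -resolvent_walks.
  have rq : complex.Re r <= q ^+ N * l2norm u.
    apply: le_trans (ler_norm _) _; rewrite -lecR.
    apply: le_trans (normc_ge_Re _) _. rewrite norm_normc lecR.
    rewrite ComplexField.Normc.normcM normc_real expr_div_n.
    rewrite ger0_norm ?invr_ge0 ?exprn_ge0 ?(ltW l0) //.
    rewrite [_ ^+ N / _]mulrC -mulrA ler_wpM2l ?invr_ge0 ?exprn_ge0 ?(ltW l0) //.
    have [uN2 uN] := iter_adjacency_bound N u2.
    exact: le_trans (ell2_coord _ uN2) uN.
  have usR : complex.Re (u y) = s + complex.Re r by rewrite us raddfD.
  rewrite ltrBrDl usR in qN; rewrite -(ltrD2r (complex.Re r)).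
  by apply: le_lt_trans qN; rewrite lerD2l.
by move: Mu; rewrite u0 ltcE /= => /andP[_]; rewrite ltNge le_max lexx orbT.
Unshelve. all: by end_near.
Qed.

End Bounded.
End Adjacency.

(** * Functional calculus of Hermitian matrices *)

Lemma hermitian_mx_eq (C : numClosedFieldType) n (M : 'M[C]_n) :
  (forall i j, M i j = (M j i)^*) -> M \is hermsymmx.
Proof.
move=> MC; apply/is_hermitianmxP; rewrite expr0 scale1r.
by apply/matrixP => i j; rewrite !mxE MC.
Qed.

Section FunctionalCalculus.
Variables (R : realType) (n : nat) (K : 'M[R[i]]_n).
Implicit Types f g : R -> R[i].
Local Notation normc := ComplexField.Normc.normc.
Local Notation P := (spectralmx K).

Lemma mxfunE f (d : 'rV[R[i]]_n) :
  (forall j, f (complex.Re (spectral_diag K 0 j)) = d 0 j) ->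
  mxfun f K = invmx P *m (diag_mx d *m P).
Proof.
move=> fd; rewrite /mxfun (_ : map_mx _ _ = d); last first.
  by apply/rowP => j; rewrite mxE fd.
by rewrite -[LHS]mulmxA.
Qed.

Lemma mxfun_row f :
  mxfun f K =
  invmx P *m (diag_mx (\row_j f (complex.Re (spectral_diag K 0 j))) *m P).
Proof. by apply: mxfunE => j; rewrite mxE. Qed.

Lemma mxfunM f g : mxfun f K *m mxfun g K = mxfun (fun t => f t * g t) K.
Proof.
rewrite [X in X *m _]mxfun_row [X in _ *m X]mxfun_row.
rewrite -[LHS]mulmxA -[X in _ *m X = _]mulmxA.
rewrite (mulKVmx (spectral_unit K)) [X in _ *m X = _]mulmxA mulmx_diag.
by apply/esym/mxfunE => j; rewrite !mxE.
Qed.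

Lemma mxfunB f g : mxfun f K - mxfun g K = mxfun (fun t => f t - g t) K.
Proof.
rewrite [X in X - _]mxfun_row [X in _ - X]mxfun_row -mulmxBr -mulmxBl -raddfB /=.
by apply/esym/mxfunE => j; rewrite !mxE.
Qed.

Lemma mxfun_cst c : mxfun (fun=> c) K = c%:M.
Proof.
rewrite /mxfun (_ : map_mx _ _ = const_mx c); last by apply/rowP => j; rewrite !mxE.
by rewrite diag_const_mx -mulmxA -scalar_mxC mulKmx ?spectral_unit.
Qed.

Lemma mxfunX f m : mxfun f K ^+ m = mxfun (fun t => f t ^+ m) K.
Proof.
elim: m => [|m IH]; first by rewrite expr0 mxfun_cst.
rewrite exprS IH -[LHS]/(mxfun f K *m mxfun (fun t => f t ^+ m) K) mxfunM.
by congr mxfun; apply/funext => t; rewrite exprS.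
Qed.

(** The product is prescribed on the spectrum only, since $1/(e^t-1)$ is no inverse at $t=0$. *)
Lemma mxfun_inv f g : (forall j, f (complex.Re (spectral_diag K 0 j)) *
    g (complex.Re (spectral_diag K 0 j)) = 1) ->
  invmx (mxfun f K) = mxfun g K.
Proof.
move=> fg1; have fg : mxfun f K *m mxfun g K = 1%:M.
  rewrite mxfunM -(mxfun_cst 1) (@mxfunE _ (const_mx 1)) => [|j].
    by rewrite (@mxfunE (fun=> 1) (const_mx 1)) // => j; rewrite mxE.
  by rewrite mxE fg1.
by have [fU _] := mulmx1_unit fg; rewrite -[LHS]mulmx1 -fg mulKmx.
Qed.

(** This integrates [f] against the spectral measure at [i]: by unitarity the inverse of [P] is its
    conjugate transpose, which gives the weights $|P_{ji}|^2$. *)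
Lemma mxfun_diag f i : mxfun f K i i =
  \sum_j f (complex.Re (spectral_diag K 0 j)) * (normc (P j i) ^+ 2)%:C.
Proof.
rewrite /mxfun invmx_unitary ?spectral_unitarymx // mxE; apply: eq_bigr => j _.
rewrite mul_mx_diag !mxE [_^* * _]mulrC -mulrA; congr (_ * _).
by rewrite rmorphXn /= -norm_normc -mulrC -normCK.
Qed.

(** The spectral measure has mass 1: integrate the constant 1. *)
Lemma spectral_weight i : \sum_j normc (P j i) ^+ 2 = 1.
Proof.
have := mxfun_diag (fun=> 1) i; rewrite mxfun_cst mxE eqxx /=.
under eq_bigr do rewrite mul1r.
by rewrite -rmorph_sum /= => /(congr1 (@complex.Re R)).
Qed.

Hypothesis hermK : K \is hermsymmx.

Lemma spectral_diag_real j :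
  spectral_diag K 0 j = (complex.Re (spectral_diag K 0 j))%:C.
Proof.
have /mxOverP/(_ 0 j) := hermitian_spectral_diag_real hermK.
by move=> /complex_realP[r ->].
Qed.

(** The spectral theorem; the eigenvalues being real, taking their real parts in [mxfun] loses
    nothing. *)
Lemma mxfun_id : mxfun (real_complex R) K = K.
Proof.
rewrite (mxfunE (fun j => esym (spectral_diag_real j))) mulmxA.
by have /hermitian_normalmx/orthomx_spectralP := hermK.
Qed.

End FunctionalCalculus.

(** * Scalar inequalities *)

Lemma expR_sub1_inv_ge (R : realType) (s : R) : 0 < s ->
  s^-1 - 1 <= (expR s - 1)^-1.
Proof.
move=> s0; have e1 : 0 < expR s - 1 by rewrite subr_gt0 expR_gt1.
have [s1|s1] := leP 1 s.
  by apply: le_trans (_ : 0 <= _); rewrite ?subr_le0 ?invf_le1 ?invr_ge0 ?(ltW e1).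
have -> : s^-1 - 1 = ((1 - s) / s) by field; rewrite gt_eqF.
(* For $s<1$, clearing denominators leaves $e^{-s} \ge 1-s$. *)
rewrite ler_pdivrMr // ler_pdivlMl //.
have := expR_ge1Dx (- s); rewrite expRN -[_^-1]mul1r ler_pdivlMr ?expR_gt0 //.
lra.
Qed.

(** With $q=(l-s)/l$, [s] times the sum is $1-q^{2N}$, and an even power is nonnegative even if
    $s>l$. *)
Lemma geometric_sum_le (R : realType) (l s : R) N : 0 < l -> 0 < s ->
  \sum_(k < N.*2) l ^- k.+1 * (l - s) ^+ k <= s^-1.
Proof.
move=> l0 s0; rewrite -[leRHS]mul1r ler_pdivlMr // mulrC.
pose q := (l - s) / l.
rewrite (_ : s * _ = 1 - q ^+ N.*2).
  by rewrite gerBl -mul2n exprM exprn_ge0 // sqr_ge0.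
have qs : s / l = 1 - q by rewrite /q; field; rewrite gt_eqF.
rewrite -[RHS]opprB subrX1 -mulNr opprB -qs -mulrA; congr (s * _); rewrite mulr_sumr.
apply: eq_bigr => k _.
by rewrite expr_div_n exprSr invfM; ring.
Qed.

(** * Hermitian matrices of norm less than [l] *)

Section MatrixOperator.
Variables (R : realType) (F : finType).
Local Notation normc := ComplexField.Normc.normc.

Lemma sum_fset_le (S : {fset F}) (f : F -> R) : (forall x, 0 <= f x) ->
  \sum_(x <- S) f x <= \sum_x f x.
Proof.
move=> f0; rewrite big_uniq ?fset_uniq //= [leLHS]big_mkcond; apply: ler_sum => x _.
by case: ifP.
Qed.

Lemma ell2_finite (u : F -> R[i]) : ell2 u.
Proof.
have s0 : 0 <= \sum_x normc (u x) ^+ 2 by apply: sumr_ge0 => x _; apply: sqr_ge0.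
suff [] : ell2 u /\ l2norm u <= Num.sqrt (\sum_x normc (u x) ^+ 2) by [].
apply: ell2_bound => [|S]; first exact: sqrtr_ge0.
by rewrite sqr_sqrtr //; apply: sum_fset_le => x; apply: sqr_ge0.
Qed.

Variable M : 'M[R[i]]_#|F|.

Lemma mxopZ (c : R) u : mxop M (fun x => c%:C * u x) = fun x => c%:C * mxop M u x.
Proof.
by apply/funext => x; rewrite /mxop mulr_sumr; apply: eq_bigr => y _; rewrite mulrCA.
Qed.

(** A crude bound by absolute row sums; it only serves to make [opnorm] a genuine supremum. *)
Lemma mxop_bound : exists C, forall u : F -> R[i],
  ell2 u -> ell2 (mxop M u) /\ l2norm (mxop M u) <= C * l2norm u.
Proof.
pose c x := \sum_y normc (M (enum_rank x) (enum_rank y)).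
exists (Num.sqrt (\sum_x c x ^+ 2)) => u u2.
have c0 x : 0 <= c x by apply: sumr_ge0 => y _; apply: normc_ge0.
apply: ell2_bound => [|S]; first by rewrite mulr_ge0 ?sqrtr_ge0 ?l2norm_ge0.
rewrite exprMn sqr_sqrtr; last by apply: sumr_ge0 => x _; apply: sqr_ge0.
rewrite mulr_suml; apply: le_trans (sum_fset_le _ _) _ => [x|].
  exact: sqr_ge0.
apply: ler_sum => x _.
rewrite -exprMn ler_pXn2r ?nnegrE ?mulr_ge0 ?normc_ge0 ?l2norm_ge0 //.
apply: le_trans (normc_sum _ _) _; rewrite mulr_suml; apply: ler_sum => y _.
by rewrite ComplexField.Normc.normcM ler_wpM2l ?normc_ge0 // ell2_coord.
Qed.

Lemma l2norm_mxop u : l2norm (mxop M u) <= opnorm (mxop M) * l2norm u.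
Proof.
have [C bound] := mxop_bound.
exact (l2norm_opnorm mxopZ bound (ell2_finite u)).
Qed.

Lemma mxop_delta x y : mxop M (delta R y) x = M (enum_rank x) (enum_rank y).
Proof.
rewrite /mxop (bigD1 y) //= big1 ?addr0 => [|z zy]; rewrite /delta.
  by rewrite eqxx mulr1.
by rewrite (negPf zy) mulr0.
Qed.

Hypothesis hermM : M \is hermsymmx.
Variable l : R.
Hypothesis Ml : opnorm (mxop M) < l.
Local Notation K := ((l%:C)%:M - M).

Lemma hermitian_shift : K \is hermsymmx.
Proof.
apply: hermitian_mx_eq => i j; rewrite !mxE rmorphB rmorphMn /= eq_sym.
rewrite (CrealP _) ?complex_real //; congr (_ - _).
have := is_hermitianmxP _ _ _ hermM; rewrite expr0 scale1r => {1}->.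
by rewrite !mxE.
Qed.

(** An eigenvalue $s\le 0$ of $l-M$ would give [M] the eigenvalue $l-s\ge l$, above its norm. The
    eigenvector [u], a column of the inverse of [spectralmx K], would then vanish. *)
Lemma spectral_shift_gt0 j : 0 < complex.Re (spectral_diag K 0 j).
Proof.
set s := complex.Re _; rewrite ltNge; apply/negP => s0.
pose u x := invmx (spectralmx K) (enum_rank x) j.
have c0 : 0 < l - s.
  by rewrite subr_gt0 (le_lt_trans s0) // (le_lt_trans _ Ml) // opnorm_ge0.
have KX : K *m invmx (spectralmx K) =
    invmx (spectralmx K) *m diag_mx (spectral_diag K).
  have /hermitian_normalmx/orthomx_spectralP {1}-> := hermitian_shift.
  by rewrite mulmxK ?spectral_unit.
have Mu x : mxop M u x = (l - s)%:C * u x.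
  rewrite rmorphB /= mulrBl -[s%:C](spectral_diag_real hermitian_shift).
  transitivity ((M *m invmx (spectralmx K)) (enum_rank x) j).
    rewrite mxE (reindex (@enum_rank F)) //=.
    exact/onW_bij/enum_rank_bij.
  rewrite -{1}(subKr (l%:C)%:M M) mulmxBl KX mul_scalar_mx mul_mx_diag !mxE.
  by rewrite [u x * _]mulrC.
have [_] := ell2_scale (l - s)^-1 (ell2_finite (mxop M u)).
rewrite (_ : (fun x => _) = u); last first.
  by apply/funext => x; rewrite Mu mulrA -rmorphM /= mulVf ?gt_eqF ?mul1r.
rewrite ger0_norm ?invr_ge0 ?(ltW c0) // ler_pdivlMl // => le1.
have u0 : l2norm u = 0.
  apply/eqP; rewrite eq_le l2norm_ge0 andbT leNgt; apply/negP => u_gt0.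
  have := le_trans le1 (l2norm_mxop u); rewrite ler_pM2r //.
  by rewrite leNgt (lt_le_trans Ml) // lerBrDr gerDl.
have uz x : u x = 0.
  apply: ComplexField.Normc.eq0_normc; apply/eqP; rewrite eq_le normc_ge0 andbT.
  by rewrite -u0; exact (ell2_coord x (ell2_finite u)).
have /matrixP/(_ j j) := mulmxV (spectral_unit K).
rewrite mxE big1 => [|i _]; first by rewrite mxE eqxx => /esym/eqP; rewrite oner_eq0.
by rewrite -(enum_valK i) -[invmx _ _ j]/(u _) uz mulr0.
Qed.

(* Keeping an even number of terms makes the remainder of the geometric series
   nonnegative, even for negative eigenvalues of M. *)
Lemma bose_ge N i : exists2 r : R,
  invmx (mxexp K - 1%:M) i i = r%:C &
  \sum_(k < N.*2) l ^- k.+1 * complex.Re ((M ^+ k) i i) - 1 <= r.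
Proof.
pose s j := complex.Re (spectral_diag K 0 j).
pose p j := normc (spectralmx K j i) ^+ 2.
have s0 j : 0 < s j := spectral_shift_gt0 j.
have l0 : 0 < l by apply: le_lt_trans Ml; apply: opnorm_ge0.
have p0 j : 0 <= p j by apply: sqr_ge0.
exists (\sum_j (expR (s j) - 1)^-1 * p j).
  rewrite -(mxfun_cst K 1) /mxexp mxfunB.
  rewrite (@mxfun_inv _ _ _ _ (fun t => ((expR t - 1)^-1)%:C)); last first.
    move=> j; rewrite -rmorphB -rmorphM /= mulfV //.
    by rewrite subr_eq0 gt_eqF // expR_gt1 s0.
  rewrite mxfun_diag rmorph_sum; apply: eq_bigr => j _.
  by rewrite [RHS]rmorphM.
have cB c : c%:M - mxfun (real_complex R) K = mxfun (fun t => c - t%:C) K.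
  by rewrite -(mxfun_cst K c) mxfunB.
(* As $M = l-K$, powers of [M] are functions of [K] and share its spectral weights. *)
have MX k : complex.Re ((M ^+ k) i i) = \sum_j (l - s j) ^+ k * p j.
  have -> : M = mxfun (fun t => l%:C - t%:C) K.
    by rewrite -cB (mxfun_id hermitian_shift) subKr.
  rewrite mxfunX mxfun_diag raddf_sum; apply: eq_bigr => j _ /=.
  by rewrite -rmorphB -rmorphXn -rmorphM.
under eq_bigr do rewrite MX mulr_sumr.
(* The subtracted 1 is spread over the weights, which leaves one scalar inequality per
   eigenvalue. *)
rewrite exchange_big /= -[X in _ - X <= _](spectral_weight K i) -sumrB.
apply: ler_sum => j _.
under eq_bigr do rewrite mulrA.
rewrite -mulr_suml -/(p j) -{2}[p j]mul1r -mulrBl ler_wpM2r //.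
by apply: le_trans _ (expR_sub1_inv_ge (s0 j)); rewrite lerD2r geometric_sum_le.
Qed.

End MatrixOperator.

(** * Finite-volume matrices and walks *)

Lemma shifted_sum_le (R : realType) (F : nat -> R) m N q :
  (forall k, 0 <= F k) ->
  \sum_(k < N) F (m + k)%N <= \sum_(k < m + (N + q)) F k.
Proof.
move=> F0; rewrite !big_split_ord /=.
by rewrite ler_wpDl ?ler_wpDr ?sumr_ge0.
Qed.

Lemma near_fset (I : choiceType) (S : {fset I}) (P : I -> nat -> Prop) :
  (forall i, \forall n \near \oo, P i n) ->
  \forall n \near \oo, forall i, i \in S -> P i n.
Proof.
move=> nearP.
have : \forall n \near \oo, forall i : S, P (val i) n.
  by apply: filter_forall => i; apply: nearP.
by apply: filterS => n Pn i iS; apply: (Pn [` iS]%fset).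
Qed.

Section FiniteVolume.
Variables (R : realType) (V : countType) (G : multigraph V).

Lemma adjacency_delta (x y : V) :
  adjacency G (delta R y) x = (G x y)%:R.
Proof.
rewrite /adjacency (@fsbigTE _ _ _ _ [fset y]%fset) => [|z]; rewrite /delta.
  by rewrite big_seq_fset1 eqxx mulr1.
by rewrite inE => /negPf ->; rewrite mulr0.
Qed.

Lemma adjacency_inE (L : {fset V}) i j :
  adjacency_in R G L i j = (G (val (enum_val i)) (val (enum_val j)))%:R.
Proof. by rewrite mxE inner_delta adjacency_delta. Qed.

Lemma hermitian_adjacency_in (L : {fset V}) : adjacency_in R G L \is hermsymmx.
Proof.
by apply: hermitian_mx_eq => i j; rewrite !adjacency_inE rmorph_nat edges_sym.
Qed.

(** Both constants merge into $\lambda_n=\|A\|-\mu_n$, the shift for which [bose_ge] is stated. *)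
Lemma hamiltonian_inE (L : {fset V}) (mu : R) :
  hamiltonian_in R G L - (mu%:C)%:M =
  ((normA R G - mu)%:C)%:M - adjacency_in R G L.
Proof.
apply/matrixP => i j.
rewrite !mxE !inner_delta /hamiltonian adjacency_delta /delta.
rewrite (inj_eq val_inj) (inj_eq enum_val_inj) rmorphB /= mulrnBl.
rewrite [LHS]addrAC; congr (_ - _ - _).
by rewrite mulr_natr.
Qed.

Lemma two_point_delta (L : {fset V}) (mu : R) (x : L) :
  two_point G L mu (restrict_to L (delta R (val x))) (restrict_to L (delta R (val x)))
  = invmx (mxexp (((normA R G - mu)%:C)%:M - adjacency_in R G L) - 1%:M)
      (enum_rank x) (enum_rank x).
Proof.
have -> : restrict_to L (delta R (val x)) = delta R x.
  by apply/funext => y; rewrite /restrict_to /delta (inj_eq val_inj).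
by rewrite /two_point inner_delta mxop_delta hamiltonian_inE.
Qed.

Variables (L : nat -> {fset V}) (nb : V -> {fset V}).
Hypothesis exL : exhaustion L.
Hypothesis nbP : neighborhoods G nb.

Lemma exhaustion_near x : \forall n \near \oo, x \in L n.
Proof.
have [LS /(_ x)[n0 xn0]] := exL; exists n0 => // n /=.
elim: n => [|n IH]; first by rewrite leqn0 => /eqP <-.
rewrite leq_eqVlt => /orP[/eqP <- //|/IH]; apply: fsubsetP (LS n) x.
Qed.

(** Walks of length [k] from [x] visit finitely many vertices, all of which lie in [L n] for large
    [n]; the induction needs the claim simultaneously on the finite set [nb x]. *)
Lemma walks_near k x y : \forall n \near \oo,
  forall (xL : x \in L n) (yL : y \in L n),
  (adjacency_in R G (L n) ^+ k) (enum_rank [` xL]%fset) (enum_rank [` yL]%fset)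
  = (walks G nb k y x)%:R.
Proof.
elim: k x => [|k IH] x.
  apply: nearW => n xL yL.
  by rewrite expr0 mxE (inj_eq enum_rank_inj) -(inj_eq val_inj).
have nbL : \forall n \near \oo, forall z, z \in nb x -> z \in L n.
  by apply: near_fset => z; apply: exhaustion_near.
apply: filterS2 nbL (near_fset (nb x) IH) => n nbL nbIH xL yL.
rewrite exprS [LHS]mxE (reindex (@enum_rank (L n))) /=; last first.
  exact/onW_bij/enum_rank_bij.
transitivity (\sum_(z : L n) ((G x (val z) * walks G nb k y (val z))%:R : R[i])).
  apply: eq_bigr => z _; rewrite adjacency_inE !enum_rankK natrM /=.
  have [->|Gxz] := posnP (G x (fsval z)); first by rewrite !mul0r.
  have zE : [` fsvalP z]%fset = z by apply: val_inj.
  by rewrite -(nbIH _ (nbP Gxz) (fsvalP z) yL) zE.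
rewrite -(big_seq_fsetE _ _ xpredT (fun z => (G x z * walks G nb k y z)%:R : R[i])) /=.
rewrite natr_sum; apply/esym/big_fset_incl; first by apply/fsubsetP.
move=> z _ znb; have [-> //|/nbP] := posnP (G x z).
by rewrite (negPf znb).
Qed.

End FiniteVolume.

(** * Transfer between vertices and conclusion *)

Lemma walks_detour (V : countType) (G : multigraph V) (nb : V -> {fset V}) :
  neighborhoods G nb -> connected_graph G ->
  forall x y, exists m, forall k,
    (walks G nb k y y <= walks G nb (m + k) x x)%N.
Proof.
move=> nbP conn x y; have [p px py] := conn x y; have [q qy qx] := conn y x.
(* The fixed loop from [x] through [y] back to [x]: each closed walk at [y] is inserted when the
   loop reaches [y]. *)
exists (size p + size q)%N => k.
have := walks_path nbP px; have := walks_path nbP qy; rewrite py qx => wq wp.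
rewrite -addnA [(size q + k)%N]addnC.
apply: leq_trans (walksM G nb _ _ _ _ y).
apply: leq_trans (leq_mul (leqnn _) (walksM G nb _ _ _ _ y)).
by rewrite mulnCA -[leqLHS]muln1 leq_mul2l muln_gt0 wp wq orbT.
Qed.

Theorem proposition5p2 (R : realType) (V : countType) (G : multigraph V)
    (L : nat -> {fset V}) (mu : nat -> R) :
  infinite_set [set: V] ->
  connected_graph G ->
  bounded_degree G ->
  exhaustion L ->
  admits_ids R G L ->
  (forall n, mu n < normA R G - opnorm (mxop (adjacency_in R G (L n)))) ->
  mu n @[n --> \oo] --> (0 : R) ->
  recurrent R G ->
  forall x : V,
    two_point G (L n) (mu n) (restrict_to (L n) (delta R x))
                       (restrict_to (L n) (delta R x))
      @[n --> \oo] --> (+oo : set_system R[i]).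
Proof.
move=> _ conn bdeg exL _ mu_lt mu0 rec x.
have [nb nbP] := exists_neighborhoods bdeg; have [D degD] := bdeg.
have [y green] := recurrent_walks nbP degD rec.
have [m detour] := walks_detour nbP conn x y.
move=> P [z [/complex_realP[M ->{z}] MP]]; set a := normA R G.
have a0 : 0 <= a := opnorm_ge0 _.
(* The factor $(a+1)^m$ dominates $l^m$, the cost of the detour; the added 1 absorbs the $-1$ of
   [bose_ge]. *)
have [l [N [al la sumM]]] := green ((`|M| + 1) * (a + 1) ^+ m).
have l0 : 0 < l by apply: le_lt_trans al.
(* The number of terms must be even and reach $m+N$, hence twice $m+N$. *)
pose Q := (m + (N + (m + N)))%N; have QE : Q = (m + N).*2 by rewrite -addnn -addnA.
have nearw : \forall n \near \oo, forall k, k \in iota 0 Q -> forall xL yL : x \in L n,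
    (adjacency_in R G (L n) ^+ k) (enum_rank [` xL]%fset) (enum_rank [` yL]%fset)
    = (walks G nb k x x)%:R.
  have := near_fset [fset k in iota 0 Q]%fset (fun k => walks_near R exL nbP k x x).
  by apply: filterS => n H k kQ; apply: H; rewrite inE.
(* For $\lambda_n<l$ each term of the series at $\lambda_n$ is at least the one at [l]. *)
have mul : \forall n \near \oo, a - mu n < l.
  have : a - mu n @[n --> \oo] --> a - 0 by apply: cvgB => //; apply: cvg_cst.
  by rewrite subr0 => /cvgr_lt/(_ l al).
apply: filterS3 (exhaustion_near exL x) mul nearw => n xL {}mul {}nearw.
rewrite /=; apply: MP.
rewrite -[x]/(val [` xL]%fset) two_point_delta.
have opn : opnorm (mxop (adjacency_in R G (L n))) < a - mu n.
  by rewrite ltrBrDr addrC -ltrBrDr.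
have n0 : 0 < a - mu n by apply: le_lt_trans opn; apply: opnorm_ge0.
have [r -> rge] := bose_ge (hermitian_adjacency_in R G (L n)) opn (m + N)
  (enum_rank [` xL]%fset).
rewrite ltcR; apply: lt_le_trans rge; rewrite -QE.
rewrite ltrBrDr.
apply: le_lt_trans (_ : `|M| + 1 < _); first by rewrite lerD2r ler_norm.
(* Multiplication by $l^m$ turns the weight $l^{-(m+k+1)}$ into the weight $l^{-(k+1)}$ of the sum
   at [y]. *)
rewrite -(ltr_pM2r (exprn_gt0 m l0)).
apply: le_lt_trans (_ : (`|M| + 1) * (a + 1) ^+ m < _).
  by rewrite ler_wpM2l ?addr_ge0 // lerXn2r ?nnegrE ?addr_ge0 ?(ltW l0) ?(ltW la).
apply: lt_le_trans sumM _.
pose F k := (a - mu n) ^- k.+1 * ((walks G nb k x x)%:R : R).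
have -> : \sum_(k < Q) (a - mu n) ^- k.+1 *
    complex.Re ((adjacency_in R G (L n) ^+ k) (enum_rank [` xL]%fset)
      (enum_rank [` xL]%fset)) = \sum_(k < Q) F k.
  apply: eq_bigr => k _; rewrite nearw ?mem_iota ?add0n ?ltn_ord //.
  by rewrite -(rmorph_nat (real_complex R)).
have F0 k : 0 <= F k by rewrite mulr_ge0 // invr_ge0 exprn_ge0 // ltW.
have lm0 : 0 <= l ^+ m by rewrite exprn_ge0 // ltW.
(* Of the [Q] nonnegative terms only those of index $m+k$ with $k<N$ are kept; they are compared one
   by one with closed walks of length [k] at [y]. *)
apply: le_trans _ (ler_wpM2r lm0 (shifted_sum_le m N (m + N) F0)).
rewrite mulr_suml; apply: ler_sum => k _.
apply: le_trans (_ : l ^- (m + k).+1 * (walks G nb (m + k) x x)%:R * l ^+ m <= _).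
  have -> : l ^- (m + k).+1 * (walks G nb (m + k) x x)%:R * l ^+ m =
      l ^- k.+1 * (walks G nb (m + k) x x)%:R.
    by rewrite -addnS exprD; field; rewrite !gt_eqF ?exprn_gt0.
  by rewrite ler_wpM2l ?invr_ge0 ?exprn_ge0 ?(ltW l0) // ler_nat.
rewrite ler_wpM2r ?exprn_ge0 ?(ltW l0) // ler_wpM2r //.
by rewrite lef_pV2 ?posrE ?exprn_gt0 // lerXn2r ?nnegrE ?(ltW l0) ?(ltW n0) ?(ltW mul).
Qed.
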